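(* For any graph $G=(V,E)$ with four types of edges, the independence model $\mathcal{J}(G)=\{\langle A,B\,|\,C\rangle : A,B,C\subseteq V \text{ pairwise disjoint},\ A\perp B\,|\,C\}$ is a compositional graphoid.
   Context: Graphs: a graph $G=(V,E)$ has a finite node set $V$ and edges of four possible types: lines (solid, undirected), arrows ($i\to j$), arcs ($i\leftrightarrow j$), and dotted lines (undirected). There are no loops, but multiple edges between the same two nodes are allowed. A walk is a list $\langle i_0,e_1,i_1,\dots,e_n,i_n\rangle$ of nodes and edges with $e_m$ having endpoints $i_{m-1},i_m$; nodes and edges may repeat. Sections and separation: a section of a walk is a maximal subwalk consisting only of solid lines (possibly a single node); a walk decomposes uniquely into sections. A section is an endpoint section if it contains an endpoint (first or last position) of the walk, otherwise an inner section. An inner section is a collider section if, of the two edges of the walk adjacent to it, both have an arrowhead pointing to the section, or one has an arrowhead pointing to the section and the other is a dotted line. All other sections, including endpoint sections, are non-collider sections. A walk is connecting given $C$ if all its collider sections intersect $C$ and all its non-collider sections are disjoint from $C$. For pairwise disjoint $A,B,C\subseteq V$, $A\perp B\,|\,C$ means there is no connecting walk given $C$ between a node of $A$ and a node of $B$. Independence models: an independence model $\mathcal{J}$ over a finite set $V$ is a set of triples $\langle A,B\,|\,C\rangle$ of pairwise disjoint subsets of $V$ ($C$ may be empty) that contains all triples $\langle \varnothing,B\,|\,C\rangle$ and $\langle A,\varnothing\,|\,C\rangle$. It is a compositional graphoid if for all pairwise disjoint $A,B,C,D\subseteq V$: (S1, symmetry) $\langle A,B|C\rangle\in\mathcal{J}\iff\langle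 B,A|C\rangle\in\mathcal{J}$; (S2, decomposition) $\langle A,B\cup D|C\rangle\in\mathcal{J}$ implies $\langle A,B|C\rangle,\langle A,D|C\rangle\in\mathcal{J}$; (S3, weak union) $\langle A,B\cup D|C\rangle\in\mathcal{J}$ implies $\langle A,B|C\cup D\rangle,\langle A,D|C\cup B\rangle\in\mathcal{J}$; (S4, contraction) $\langle A,B|C\cup D\rangle,\langle A,D|C\rangle\in\mathcal{J}$ if and only if $\langle A,B\cup D|C\rangle\in\mathcal{J}$; (S5, intersection) $\langle A,B|C\cup D\rangle,\langle A,D|C\cup B\rangle\in\mathcal{J}$ implies $\langle A,B\cup D|C\rangle\in\mathcal{J}$; (S6, composition) $\langle A,B|C\rangle,\langle A,D|C\rangle\in\mathcal{J}$ implies $\langle A,B\cup D|C\rangle\in\mathcal{J}$. *)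

(* Defs.v *)
From mathcomp Require Export all_boot.

Set Implicit Arguments.
Unset Strict Implicit.
Unset Printing Implicit Defensive.

Inductive edge_kind := Line | Arrow | Arc | Dotted.

(* Edges are primitive objects, so parallel edges (of the same or of different
   kinds) are allowed.  An Arrow points from [src] to [tgt]; for the other three
   kinds the order of the two endpoints carries no information. *)
Record graph := Graph {
  node :> finType;
  edge : Type;
  kind : edge -> edge_kind;
  src : edge -> node;
  tgt : edge -> node;
  no_loop : forall e, src e != tgt e
}.

Section GraphDefs.
Variable G : graph.
Implicit Types (e : edge G) (x y v : G) (A B C : {set G}) (i j k : nat).

Definition is_line e : bool := if kind e is Line then true else false.
Definition is_dotted e : bool := if kind e is Dotted then true else false.

Definition joins e x y : bool :=
  (src e == x) && (tgt e == y) || (src e == y) && (tgt e == x).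

Definition arrowhead_at v e : bool :=
  match kind e with
  | Arrow => tgt e == v
  | Arc => (src e == v) || (tgt e == v)
  | Line | Dotted => false
  end.

(* The list <i_0, e_1, i_1, ..., e_n, i_n> is encoded as the pair
   (i_0, [:: (e_1, i_1); ...; (e_n, i_n)]). *)
Definition walk_data := (G * seq (edge G * G))%type.
Implicit Type w : walk_data.

Fixpoint walk_from x (s : seq (edge G * G)) : bool :=
  if s is (e, y) :: s' then joins e x y && walk_from y s' else true.

Definition is_walk w : bool := walk_from w.1 w.2.

Definition walk_length w : nat := size w.2.

Definition walk_nodes w : seq G := w.1 :: unzip2 w.2.

(* The node at position k, for 0 <= k <= walk_length w. *)
Definition node_at w k : G := nth w.1 (walk_nodes w) k.

(* The edge between positions k and k+1, i.e. e_(k+1), satisfies P. *)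
Definition edge_at w k (P : pred (edge G)) : bool :=
  if onth (unzip1 w.2) k is Some e then P e else false.

(* A subwalk is given by its first and last positions i <= j. *)
Definition line_subwalk w i j : Prop :=
  i <= j <= walk_length w /\ forall k, i <= k < j -> edge_at w k is_line.

Definition is_section w i j : Prop :=
  line_subwalk w i j /\
  forall i' j', i' <= i -> j <= j' -> line_subwalk w i' j' -> i' = i /\ j' = j.

Definition endpoint_section w i j : bool := (i == 0) || (j == walk_length w).

(* The two edges of the walk adjacent to an inner section from position i to
   position j are the ones at i.-1 and j; they touch it at node_at w i and
   node_at w j respectively. *)
Definition collider_section w i j : bool :=
  let head_left := edge_at w i.-1 (arrowhead_at (node_at w i)) in
  let head_right := edge_at w j (arrowhead_at (node_at w j)) in
  ~~ endpoint_section w i j &&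
  [|| head_left && head_right,
      head_left && edge_at w j is_dotted
    | edge_at w i.-1 is_dotted && head_right].

Definition section_meets w i j C : Prop :=
  exists2 k, i <= k <= j & node_at w k \in C.

Definition connecting w C : Prop :=
  forall i j, is_section w i j ->
    (collider_section w i j -> section_meets w i j C) /\
    (~~ collider_section w i j -> ~ section_meets w i j C).

Definition separated A B C : Prop :=
  ~ exists w, [/\ is_walk w, node_at w 0 \in A,
                  node_at w (walk_length w) \in B & connecting w C].

End GraphDefs.

Section IndependenceModels.
Variable V : finType.
Implicit Types A B C D : {set V}.

Definition disjoint3 A B C : bool :=
  [&& [disjoint A & B], [disjoint A & C] & [disjoint B & C]].

Definition disjoint4 A B C D : bool :=
  [&& disjoint3 A B C, [disjoint A & D], [disjoint B & D] & [disjoint C & D]].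

(* [J A B C] says that the triple <A, B | C> belongs to J. *)
Variable J : {set V} -> {set V} -> {set V} -> Prop.

Record independence_model : Prop := IndependenceModel {
  im_disjoint : forall A B C, J A B C -> disjoint3 A B C;
  im_empty_l : forall B C, disjoint3 set0 B C -> J set0 B C;
  im_empty_r : forall A C, disjoint3 A set0 C -> J A set0 C
}.

Record compositional_graphoid : Prop := CompositionalGraphoid {
  cg_model : independence_model;
  cg_symmetry : forall A B C, disjoint3 A B C ->
    (J A B C <-> J B A C);
  cg_decomposition : forall A B C D, disjoint4 A B C D ->
    J A (B :|: D) C -> J A B C /\ J A D C;
  cg_weak_union : forall A B C D, disjoint4 A B C D ->
    J A (B :|: D) C -> J A B (C :|: D) /\ J A D (C :|: B);
  cg_contraction : forall A B C D, disjoint4 A B C D ->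
    (J A B (C :|: D) /\ J A D C <-> J A (B :|: D) C);
  cg_intersection : forall A B C D, disjoint4 A B C D ->
    J A B (C :|: D) /\ J A D (C :|: B) -> J A (B :|: D) C;
  cg_composition : forall A B C D, disjoint4 A B C D ->
    J A B C /\ J A D C -> J A (B :|: D) C
}.

End IndependenceModels.

Definition graph_model (G : graph) (A B C : {set G}) : Prop :=
  disjoint3 A B C /\ separated A B C.

(* Main.v *)
(** Separation against a union of target sets amounts to separation against each
    of them, which gives decomposition and composition.  Weak union, contraction
    and intersection all rest on cutting a walk at a node: the sections before
    the cut are unchanged, and the section that is cut becomes an endpoint
    section, hence a non-collider.  So a walk whose first offending section
    meets [D] yields a connecting walk ending in [D]. *)
Require Import Defs.
From mathcomp Require Import all_boot.
From mathcomp Require Import zify.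

Set Implicit Arguments.
Unset Strict Implicit.
Unset Printing Implicit Defensive.

Section Walks.
Variable G : graph.
Implicit Types (w : walk_data G) (A B C D : {set G}) (i j k m : nat).

(** * Truncation of a walk at a node *)

Definition take_walk k w : walk_data G := (w.1, take k w.2).

Lemma walk_length_take k w : k <= walk_length w -> walk_length (take_walk k w) = k.
Proof. by move=> kn; rewrite /walk_length size_takel. Qed.

Lemma is_walk_take k w : is_walk w -> is_walk (take_walk k w).
Proof.
case: w => x s; rewrite /is_walk /=.
elim: s x k => [|[e y] s IHs] x [|k] //= /andP[-> ys] /=.
exact: IHs.
Qed.

Lemma node_at_take k w m : m <= k -> node_at (take_walk k w) m = node_at w m.
Proof.
move=> mk; rewrite /node_at /walk_nodes /= /unzip2 map_take.
by rewrite -[w.1 :: take _ _]/(take k.+1 (w.1 :: _)) nth_take.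
Qed.

Lemma edge_at_take k w m P : m < k -> edge_at (take_walk k w) m P = edge_at w m P.
Proof.
by move=> mk; rewrite /edge_at /= /unzip1 map_take !onthE map_take nth_take.
Qed.

Lemma line_subwalk_take k w i j : k <= walk_length w -> j <= k ->
  line_subwalk (take_walk k w) i j <-> line_subwalk w i j.
Proof.
move=> kn jk; rewrite /line_subwalk walk_length_take //.
split=> -[ijn lines]; split; try lia.
  by move=> m mij; rewrite -(@edge_at_take k) ?lines //; lia.
by move=> m mij; rewrite edge_at_take ?lines //; lia.
Qed.

Lemma line_subwalk_cat w i j k :
  line_subwalk w i j -> line_subwalk w j k -> line_subwalk w i k.
Proof.
move=> [ij lij] [jk ljk]; split=> [|m mik]; first lia.
by case: (ltnP m j) => mj; [apply: lij | apply: ljk]; lia.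
Qed.

Lemma line_subwalk_sub w i j i' j' : i <= i' -> i' <= j' -> j' <= j ->
  line_subwalk w i j -> line_subwalk w i' j'.
Proof.
move=> ii' ij' jj' [ij lij]; split=> [|m mij]; first lia.
by apply: lij; lia.
Qed.

(** Glued to the rest of the section from [k] to [j], the line subwalk would otherwise extend the
    section to the left, against maximality. *)
Lemma section_line_left w i j k m : is_section w i j -> i <= k <= j ->
  line_subwalk w m k -> i <= m.
Proof.
move=> [lij maxij] /andP[ik kj] lmk; rewrite leqNgt; apply/negP=> mi.
have lkj : line_subwalk w k j by apply: line_subwalk_sub lij.
have [] := maxij m j (ltnW mi) (leqnn j) (line_subwalk_cat lmk lkj) => ? ?.
lia.
Qed.

(** A line subwalk of [w] running past the cut restricts to one ending at [k]. Since [j < k], it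
    would already enlarge the section in the truncated walk. *)
Lemma is_section_take k w i j : k <= walk_length w -> j < k ->
  is_section (take_walk k w) i j -> is_section w i j.
Proof.
move=> kn jk [lij maxij].
split; first by apply/(line_subwalk_take i kn (ltnW jk)).
move=> i' j' i'i jj' lij'; have [ij _] := lij.
case: (leqP j' k) => j'k.
  by apply: maxij => //; apply/(line_subwalk_take i' kn j'k).
have lk : line_subwalk (take_walk k w) i' k.
  by apply/line_subwalk_take => //; apply: line_subwalk_sub lij'; lia.
by have [] := maxij i' k i'i (ltnW jk) lk => ? ?; lia.
Qed.

(** Strictness of [j < k] keeps the edge following the section and prevents the section from
    becoming an endpoint section. *)
Lemma collider_section_take k w i j : k <= walk_length w -> i <= j -> j < k ->
  collider_section (take_walk k w) i j = collider_section w i j.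
Proof.
move=> kn ij jk; rewrite /collider_section /endpoint_section.
rewrite walk_length_take // (ltn_eqF jk) (ltn_eqF (leq_trans jk kn)).
rewrite !node_at_take ?edge_at_take //; lia.
Qed.

(** Makes meeting a set decidable, so that [separated_weak_union] can argue by contradiction without
    classical axioms. *)
Lemma section_meetsP w i j C :
  reflect (section_meets w i j C)
          (has (fun k => node_at w k \in C) (iota i (j.+1 - i))).
Proof.
apply: (iffP hasP) => -[k kij kC]; exists k => //; move: kij; rewrite mem_iota; lia.
Qed.

Lemma section_meets_sub w i j C D : C \subset D ->
  section_meets w i j C -> section_meets w i j D.
Proof. by move=> /subsetP CD [k kij kC]; exists k; rewrite ?CD. Qed.

Lemma section_meets_take k w i j C : j <= k ->
  section_meets (take_walk k w) i j C <-> section_meets w i j C.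
Proof.
move=> jk; split=> -[m mij mC]; exists m => //.
  by rewrite -(@node_at_take k) //; lia.
by rewrite node_at_take //; lia.
Qed.

(** A section of the truncated walk either ends before [i], and is then a section of [w] of the same
    type, or is the final one, which lies inside the section from [i] to [j] and so avoids [C]. Only
    sections before [i] are assumed good, so the cut section may itself be an offending collider. *)
Lemma connecting_take k w i j C :
    is_section w i j -> i <= k <= j -> ~ section_meets w i j C ->
    (forall i' j', j' < i -> is_section w i' j' ->
      (collider_section w i' j' -> section_meets w i' j' C) /\
      (~~ collider_section w i' j' -> ~ section_meets w i' j' C)) ->
  connecting (take_walk k w) C.
Proof.
move=> sij kij nC good i' j' s'.
have [[/andP[ij jn] lij] maxij] := sij.
have kn : k <= walk_length w by lia.
have [[ij' l'] max'] := s'; rewrite walk_length_take // in ij'.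
case: (ltnP j' k) => j'k; last first.
  have {j'k} ej' : j' = k by lia.
  subst j'; rewrite /collider_section /endpoint_section walk_length_take // eqxx orbT.
  split=> // _ /(section_meets_take _ _ _ (leqnn k)) [m mij mC].
  apply: nC; exists m => //.
  have : i <= i'; last by lia.
  apply: (section_line_left sij kij).
  by apply/(line_subwalk_take i' kn (leqnn k)); case: s' => [].
have s : is_section w i' j' by apply: is_section_take s'.
(* A section ending in [[i, k)] is impossible: the solid lines up to [k] would prolong it. *)
case: (ltnP j' i) => j'i; last first.
  have lik : line_subwalk (take_walk k w) i k.
    apply/line_subwalk_take => //; apply: (@line_subwalk_sub _ i j); try lia.
    by case: sij.
  have i'i : i <= i'.
    apply: (@section_line_left w i j j') => //; first lia.
    by case: s.
  have l'' : line_subwalk (take_walk k w) i' k.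
    by apply: line_subwalk_sub lik; lia.
  by have [] := max' i' k (leqnn _) (ltnW j'k) l'' => ? ?; lia.
have [gc gn] := good i' j' j'i s.
have ij'' : i' <= j' by lia.
rewrite collider_section_take //.
split=> [/gc /section_meets_take|/gn n /section_meets_take]; first by apply; apply: ltnW.
by move=> /(_ (ltnW j'k)).
Qed.

(** * Graphoid properties obtained by cutting walks *)

Lemma separatedUr A B C D :
  separated A (B :|: D) C <-> separated A B C /\ separated A D C.
Proof.
split=> [sep|[sepB sepD] [w [ww wA /setUP[wB|wD] cw]]].
- by split=> -[w [ww wA wE cw]]; apply: sep; exists w; split=> //; apply/setUP; [left|right].
- by apply: sepB; exists w.
- by apply: sepD; exists w.
Qed.

Lemma separated_weak_union A B C D :
  separated A B C -> separated A D C -> separated A B (C :|: D).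
Proof.
move=> sepB sepD [w [ww wA wB cw]].
have noncol i j : is_section w i j -> ~~ collider_section w i j -> ~ section_meets w i j C.
  by move=> /cw [_ n] /n nCD /(section_meets_sub (subsetUl C D)).
have col i j : is_section w i j -> collider_section w i j -> section_meets w i j C.
  (* Strong induction on the right end treats the offending section as the first one: all earlier
     colliders already meet [C]. *)
  elim/ltn_ind: j i => j IHj i sij cij.
  apply/section_meetsP/negPn/negP => /section_meetsP nC.
  have [[/andP[ij jn] _] _] := sij.
  have [k kij /setUP[kC|kD]] := (cw i j sij).1 cij; first by case: nC; exists k.
  have kn : k <= walk_length w by lia.
  apply: sepD; exists (take_walk k w); split.
  - exact: is_walk_take.
  - by rewrite node_at_take.
  - by rewrite walk_length_take ?node_at_take.
  apply: (@connecting_take k w i j) => // i' j' j'i s'; split; last exact: noncol.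
  by apply: IHj s'; lia.
by apply: sepB; exists w; split=> // i j s; split; [apply: col | apply: noncol].
Qed.

(** Enlarging the conditioning set can only help collider sections, so only non-collider sections
    need checking. *)
Lemma connecting_setU w C D : connecting w C ->
    (forall i j k, is_section w i j -> ~~ collider_section w i j -> i <= k <= j ->
      node_at w k \notin D) ->
  connecting w (C :|: D).
Proof.
move=> cw nD i j s; have [c n] := cw i j s; split=> [/c|nc].
  by apply: section_meets_sub; apply: subsetUl.
move=> [k kij /setUP[kC|kD]]; first by apply: (n nc); exists k.
by move: (nD i j k s nc kij); rewrite kD.
Qed.

Lemma connecting_cut w i j k C : connecting w C -> is_section w i j ->
  ~~ collider_section w i j -> i <= k <= j -> connecting (take_walk k w) C.
Proof.
move=> cw s nc kij; apply: (@connecting_take k w i j) => //.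
  exact: (cw i j s).2.
by move=> i' j' _; apply: cw.
Qed.

(** A connecting walk given [C] either has a non-collider section meeting [D], where cutting gives a
    connecting walk from [A] to [D], or stays connecting given [C :|: D]. *)
Lemma separated_contraction A B C D :
  separated A B (C :|: D) -> separated A D C -> separated A B C.
Proof.
move=> sepB sepD [w [ww wA wB cw]].
apply: sepB; exists w; split=> //; apply: connecting_setU => // i j k s nc kij.
have [[/andP[ij jn] _] _] := s; have kn : k <= walk_length w by lia.
apply/negP=> kD; apply: sepD; exists (take_walk k w); split.
- exact: is_walk_take.
- by rewrite node_at_take.
- by rewrite walk_length_take ?node_at_take.
- exact: connecting_cut cw s nc kij.
Qed.

Lemma separated_intersection A B C D : [disjoint B & D] ->
  separated A B (C :|: D) -> separated A D (C :|: B) -> separated A (B :|: D) C.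
Proof.
move=> disBD sepB sepD [w].
(* Descent on the length: walks ending in [B] and in [D] are treated together, because a cut can
   exchange the two targets. *)
have [n] := ubnP (walk_length w); elim: n w => // n IHn w wn [ww wA wBD cw].
(* A section meeting the other target cuts off a strictly shorter walk, since
   the last node of [w] is not in that target. *)
have cut (E F : {set G}) : F \subset B :|: D -> [disjoint E & F] ->
    node_at w (walk_length w) \in E ->
    connecting w (C :|: F).
  move=> /subsetP FBD disEF wE; apply: connecting_setU => // i j k s nc kij.
  have [[/andP[ij jn] _] _] := s; have kn : k <= walk_length w by lia.
  apply/negP=> kF; apply: (IHn (take_walk k w)).
    rewrite walk_length_take //; have [ek|nek] := eqVneq k (walk_length w); last lia.
    by move: kF; rewrite ek (disjointFr disEF wE).
  split.
  - exact: is_walk_take.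
  - by rewrite node_at_take.
  - by rewrite walk_length_take ?node_at_take // FBD.
  - exact: connecting_cut cw s nc kij.
case/setUP: wBD => [wB|wD].
  by apply: sepB; exists w; split=> //; apply: cut wB => //; apply: subsetUr.
apply: sepD; exists w; split=> //; apply: cut wD => //; first exact: subsetUl.
by rewrite disjoint_sym.
Qed.

(** * Reversal of walks, for symmetry *)

(** The old last node becomes the start, so [belast] supplies the nodes to be paired with the
    reversed edges. *)
Definition rev_walk w : walk_data G :=
  (last w.1 (unzip2 w.2), zip (rev (unzip1 w.2)) (rev (belast w.1 (unzip2 w.2)))).

Lemma unzip1_rev_walk w : unzip1 (rev_walk w).2 = rev (unzip1 w.2).
Proof. by rewrite unzip1_zip // !size_rev size_belast !size_map. Qed.

Lemma walk_nodes_rev w : walk_nodes (rev_walk w) = rev (walk_nodes w).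
Proof.
rewrite /walk_nodes /= unzip2_zip ?size_rev ?size_belast ?size_map //.
by rewrite [in RHS]lastI rev_rcons.
Qed.

Lemma walk_length_rev w : walk_length (rev_walk w) = walk_length w.
Proof.
by rewrite /walk_length -(size_map fst) -/(unzip1 _) unzip1_rev_walk size_rev size_map.
Qed.

Lemma node_at_rev w k : k <= walk_length w ->
  node_at (rev_walk w) k = node_at w (walk_length w - k).
Proof.
move=> kn; have sz : size (walk_nodes w) = (walk_length w).+1 by rewrite /= size_map.
rewrite /node_at walk_nodes_rev nth_rev ?sz ?subSS //.
by apply: set_nth_default; rewrite sz; lia.
Qed.

Lemma edge_at_rev w k P : k < walk_length w ->
  edge_at (rev_walk w) k P = edge_at w (walk_length w - k.+1) P.
Proof.
move=> kn; rewrite /edge_at unzip1_rev_walk !onthE map_rev.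
by rewrite nth_rev !size_map.
Qed.

Lemma walk_from_rcons (x y : G) s e :
  walk_from x (rcons s (e, y)) = walk_from x s && joins e (last x (unzip2 s)) y.
Proof.
by elim: s x => [|[e' z] s IHs] x /=; rewrite ?andbT // IHs andbA.
Qed.

Lemma is_walk_rev w : is_walk w -> is_walk (rev_walk w).
Proof.
case: w => x s; rewrite /is_walk /rev_walk /=.
elim: s x => //= -[e y] s IHs x /= /andP[jxy /IHs wys].
rewrite !rev_cons zip_rcons ?size_rev ?size_belast ?size_map //.
rewrite walk_from_rcons wys /= unzip2_zip ?size_rev ?size_belast ?size_map //.
have -> : last (last y (unzip2 s)) (rev (belast y (unzip2 s))) = y.
  by rewrite -[LHS]/(last y (_ :: _)) -rev_rcons -lastI rev_cons last_rcons.
by rewrite /joins orbC.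
Qed.

Lemma line_subwalk_rev w i j : i <= j <= walk_length w ->
  line_subwalk (rev_walk w) i j <->
  line_subwalk w (walk_length w - j) (walk_length w - i).
Proof.
move=> ijn; rewrite /line_subwalk walk_length_rev.
split=> -[_ lines]; split=> [|k kij]; try lia; last first.
  by rewrite edge_at_rev ?lines //; lia.
have -> : k = walk_length w - (walk_length w - k.+1).+1 by lia.
by rewrite -edge_at_rev ?lines //; lia.
Qed.

Lemma is_section_rev w i j : is_section (rev_walk w) i j ->
  is_section w (walk_length w - j) (walk_length w - i).
Proof.
move=> [lij maxij]; have [ijn _] := lij; rewrite walk_length_rev in ijn.
split; first exact/line_subwalk_rev.
move=> i' j' i'j ij' lij'; have [ijn' _] := lij'.
have [] := maxij (walk_length w - j') (walk_length w - i'); try lia.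
by apply/line_subwalk_rev; rewrite ?subKn //; lia.
Qed.

(** Reversal exchanges the two edges adjacent to a section, and the collider condition is symmetric
    in them. *)
Lemma collider_section_rev w i j : i <= j <= walk_length w ->
  collider_section (rev_walk w) i j =
  collider_section w (walk_length w - j) (walk_length w - i).
Proof.
move=> ijn; rewrite /collider_section /endpoint_section walk_length_rev.
have -> : (walk_length w - j == 0) = (j == walk_length w) by lia.
have -> : (walk_length w - i == walk_length w) = (i == 0) by lia.
(* Endpoint sections are dismissed first; for inner ones [i.-1] and [j] index genuine edges, as
   [edge_at_rev] requires. *)
rewrite orbC; case: eqP => //= jn; case: eqP => //= i0.
rewrite !node_at_rev ?edge_at_rev; try lia.
have -> : walk_length w - i.-1.+1 = walk_length w - i by lia.
have -> : walk_length w - j.+1 = (walk_length w - j).-1 by lia.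
by rewrite andbC; congr orb; rewrite orbC andbC; congr orb; rewrite andbC.
Qed.

Lemma section_meets_rev w i j C : i <= j <= walk_length w ->
  section_meets (rev_walk w) i j C <->
  section_meets w (walk_length w - j) (walk_length w - i) C.
Proof.
move=> ijn; split=> -[k kij kC]; exists (walk_length w - k); try lia.
  by rewrite -node_at_rev //; lia.
by rewrite node_at_rev ?subKn //; lia.
Qed.

Lemma connecting_rev w C : connecting w C -> connecting (rev_walk w) C.
Proof.
move=> cw i j s; have [[ijn _] _] := s; rewrite walk_length_rev in ijn.
have [c n] := cw _ _ (is_section_rev s); rewrite collider_section_rev //.
have := section_meets_rev C ijn; tauto.
Qed.

Lemma separated_sym A B C : separated A B C -> separated B A C.
Proof.
move=> sep [w [ww wB wA cw]]; apply: sep; exists (rev_walk w); split.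
- exact: is_walk_rev.
- by rewrite node_at_rev // subn0.
- by rewrite walk_length_rev node_at_rev // subnn.
- exact: connecting_rev.
Qed.

End Walks.

(** * Disjointness of the triples, and assembly of the axioms *)

Lemma disjointUr (T : finType) (A B C : {set T}) :
  [disjoint A & B :|: C] = [disjoint A & B] && [disjoint A & C].
Proof. by rewrite -!setI_eq0 setIUr setU_eq0. Qed.

Lemma disjoint3_sym (T : finType) (A B C : {set T}) :
  disjoint3 A B C = disjoint3 B A C.
Proof. by rewrite /disjoint3 [in RHS]disjoint_sym; congr andb; rewrite andbC. Qed.

Lemma disjoint4_subsets (T : finType) (A B C D : {set T}) : disjoint4 A B C D ->
  [disjoint B & D] /\
  [/\ disjoint3 A B C, disjoint3 A D C, disjoint3 A B (C :|: D),
      disjoint3 A D (C :|: B) & disjoint3 A (B :|: D) C].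
Proof.
move=> /and4P[/and3P[AB AC BC] AD BD CD].
rewrite /disjoint3 !disjointUr (disjoint_sym (B :|: D)) (disjoint_sym D B).
by rewrite (disjoint_sym D C) !disjointUr (disjoint_sym C B) AB AC BC AD BD CD.
Qed.

Theorem theorem1 (G : graph) : compositional_graphoid (@graph_model G).
Proof.
split.
- split=> [A B C []//|B C dis|A C dis]; split=> // -[w []];
    by rewrite !inE.
- by move=> A B C _; split=> -[dis sep]; split; rewrite ?(disjoint3_sym _ A) // ;
    rewrite 1?disjoint3_sym //; apply: separated_sym.
- by move=> A B C D /disjoint4_subsets[_ [? ? ? ? ?]] [_ /separatedUr[]].
- move=> A B C D /disjoint4_subsets[_ [? ? ? ? ?]] [_ /separatedUr[sB sD]].
  by split; split=> //; apply: separated_weak_union.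
- move=> A B C D /disjoint4_subsets[_ [? ? ? ? ?]]; split.
    move=> [[_ sB] [_ sD]]; split=> //; apply/separatedUr; split=> //.
    exact: separated_contraction sB sD.
  (* The converse of contraction combines decomposition with weak union. *)
  move=> [_ /separatedUr[sB sD]]; split; split=> //.
  exact: separated_weak_union.
- move=> A B C D /disjoint4_subsets[? [? ? ? ? ?]] [[_ sB] [_ sD]]; split=> //.
  exact: separated_intersection.
- move=> A B C D /disjoint4_subsets[_ [? ? ? ? ?]] [[_ sB] [_ sD]]; split=> //.
  exact/separatedUr.
Qed.
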